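(* Let $f(u,u_x)$ and $g(u,u_x)$ be functions that are continuous in $u$ and $C^1$ in $u_x$. The nonlinear dispersive wave equation $$m_t+f(u,u_x)m+(g(u,u_x)m)_x=0,\qquad m=u-u_{xx},$$ possesses dynamical peaked waves $u(x,t)=A(t)e^{-|x-X(t)|}$ with a time-dependent (i.e. non-constant) amplitude $A(t)$ if and only if $$\int_{-a}^{a}f^+(a,y)\,dy\neq0\quad\text{for some } a\in\mathbb{R},$$ where $f^+(u,v)=\tfrac12(f(u,v)+f(u,-v))$. This inequality is equivalent to the condition that the term $f_0(u)$ in the representation $$f(u,u_x)=f^-(u,u_x)+\int_{u}^{u_x}\tilde f^-(u,y)\,dy+u_x\tilde f^-(u,u_x)+f_0(u)$$ is non-zero (i.e. not identically zero).
   Context: Dynamical peaked waves are the single-peakon weak solutions $u(x,t)=A(t)e^{-|x-X(t)|}$, with $A(t)\neq0$, of the given wave equation; they are characterised by $$\dot A=\tfrac12[F(u,u_x)]_X=-F^-(A,A),\qquad \dot X=-\tfrac12[G(u,u_x)]_X/A=G^-(A,A)/A,$$ where $F=\int f\,du_x$, $G=\int g\,du_x$ are antiderivatives in the second argument, $[\cdot]_X$ is the jump across $x=X(t)$ (right limit minus left limit), and $F^-(u,v)=\tfrac12(F(u,v)-F(u,-v))$, $G^-(u,v)=\tfrac12(G(u,v)-G(u,-v))$ are the odd parts in the second argument. In the representation of $f$: $f^-(u,v)=\tfrac12(f(u,v)-f(u,-v))$ is the odd part of $f$ in $v=u_x$; writing $F^-(u,v)=v\,\tilde F^+(u,v)$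 with $\tilde F^+$ even in $v$, one sets $\tilde f^-=\partial_v\tilde F^+$ (odd in $v$), and $f_0(u)=\tilde F^+(u,u)=F^-(u,u)/u$.
   Formalization: ''Continuous in u and C^1 in u_x'' is taken to include joint continuity of f and g in (u,u_x); with continuity in each variable separately the integral can be non-zero at a single isolated a, and then no peaked wave with non-constant amplitude exists. *)

(* Defs.v *)
From Stdlib Require Import Reals.
From Coquelicot Require Import Coquelicot.
Open Scope R_scope.

Definition even_part (h : R -> R -> R) (u v : R) : R := (h u v + h u (- v)) / 2.
Definition odd_part (h : R -> R -> R) (u v : R) : R := (h u v - h u (- v)) / 2.

(* Continuity is joint in (u, v): continuity in u for each fixed v alone would
   not make the integrals of h(u,.) continuous in u. *)
Definition C0_C1 (h : R -> R -> R) : Prop :=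
  (forall u v, continuity_2d_pt h u v) /\
  (forall u v, ex_derive (h u) v /\ continuous (Derive (h u)) v).

(* The antiderivative in the second argument that vanishes at v = 0.  Neither
   odd_part (antider h) nor jumps of antider h (u, u_x) for continuous u depend
   on this choice. *)
Definition antider (h : R -> R -> R) (u v : R) : R := RInt (h u) 0 v.

(* F^-(u,v) / v, where F = antider f; at v = 0 it takes the limiting value
   d/dv F^-(u,0) = f(u,0), so that it is differentiable in v everywhere. *)
Definition Ftilde (f : R -> R -> R) (u v : R) : R :=
  if Req_EM_T v 0 then f u 0 else odd_part (antider f) u v / v.

Definition ftilde (f : R -> R -> R) (u v : R) : R := Derive (Ftilde f u) v.

Definition f0 (f : R -> R -> R) (u : R) : R := Ftilde f u u.

(* Functions of space and time are written h x t. *)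
Definition dx (h : R -> R -> R) (x t : R) : R := Derive (fun y => h y t) x.
Definition dt (h : R -> R -> R) (x t : R) : R := Derive (fun s => h x s) t.

(* D i j is the partial derivative of order i in x and j in t. *)
Definition smooth (phi : R -> R -> R) : Prop :=
  exists D : nat -> nat -> R -> R -> R,
    (forall x t, D 0%nat 0%nat x t = phi x t) /\
    (forall i j x t,
       is_derive (fun y => D i j y t) x (D (S i) j x t) /\
       is_derive (fun s => D i j x s) t (D i (S j) x t) /\
       continuity_2d_pt (D i j) x t).

Definition supported_in (xa xb ta tb : R) (phi : R -> R -> R) : Prop :=
  forall x t, phi x t <> 0 -> xa <= x <= xb /\ ta <= t <= tb.

Definition in_itv (t1 t2 : Rbar) (t : R) : Prop := Rbar_lt t1 t /\ Rbar_lt t t2.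

(* j is the jump of h across c: right limit minus left limit. *)
Definition is_jump (h : R -> R) (c j : R) : Prop :=
  exists l r : R,
    filterlim h (at_left c) (locally l) /\
    filterlim h (at_right c) (locally r) /\
    j = r - l.

(* Weak solutions on the time interval (t1,t2) of
     m_t + f(u,u_x) m + (g(u,u_x) m)_x = 0,   m = u - u_xx,
   for u continuous, of class C^2 in x off the curve x = X(t), and with
   one-sided limits of u_x on the curve.  All derivatives of m_t, and the outer
   x-derivative of the last term, are moved onto the test function.  The product
   f(u,u_x) u_xx = (F(u,u_x))_x - u_x F_u(u,u_x), with F = antider f, is the
   classical function off the curve plus the Dirac mass [F(u,u_x)]_X on it;
   this form also makes sense when f is only continuous in u.  Likewise for
   g, G.  The values of dx u at x = X(t), where u_x does not exist, do not affect
   the integrals.  Since (t1,t2) is an interval, every compactly supported test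
   function on R x (t1,t2) is supported in a rectangle as below. *)
Definition weak_solution (f g : R -> R -> R) (t1 t2 : Rbar) (X : R -> R)
    (u : R -> R -> R) : Prop :=
  exists JF JG : R -> R,
    (forall t, in_itv t1 t2 t ->
       is_jump (fun x => antider f (u x t) (dx u x t)) (X t) (JF t) /\
       is_jump (fun x => antider g (u x t) (dx u x t)) (X t) (JG t)) /\
    (forall (phi : R -> R -> R) (xa xb ta tb : R),
       smooth phi ->
       xa <= xb -> ta <= tb -> in_itv t1 t2 ta -> in_itv t1 t2 tb ->
       supported_in xa xb ta tb phi ->
       let integrand x t :=
         - u x t * (dt phi x t - dx (dx (dt phi)) x t)
         + f (u x t) (dx u x t) * (u x t - dx (dx u) x t) * phi x t
         - g (u x t) (dx u x t) * (u x t - dx (dx u) x t) * dx phi x t in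
       (forall t, ta <= t <= tb -> ex_RInt (fun x => integrand x t) xa xb) /\
       is_RInt (fun t => RInt (fun x => integrand x t) xa xb
                         - JF t * phi (X t) t + JG t * dx phi (X t) t)
               ta tb 0).

Definition C1_on (t1 t2 : Rbar) (h : R -> R) : Prop :=
  forall t, in_itv t1 t2 t -> ex_derive h t /\ continuous (Derive h) t.

Definition peakon (A X : R -> R) (x t : R) : R := A t * exp (- Rabs (x - X t)).

Definition dynamical_peaked_wave (f g : R -> R -> R) (t1 t2 : Rbar)
    (A X : R -> R) : Prop :=
  C1_on t1 t2 A /\ C1_on t1 t2 X /\
  (forall t, in_itv t1 t2 t -> A t <> 0) /\
  weak_solution f g t1 t2 X (peakon A X).

Definition nonconstant_on (t1 t2 : Rbar) (A : R -> R) : Prop :=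
  exists s t, in_itv t1 t2 s /\ in_itv t1 t2 t /\ A s <> A t.

(* Main.v *)
(** Testing the weak form against [phi], the part [u - u_xx] of a peakon is
    [2 A] times the Dirac mass at [X], so that after an integration by parts in t
    the weak form reads
      int ((2 A' - JF) phi + (2 A X' + JG) phi_x) dt = 0   along x = X(t),
    with JF, JG the jumps of F(u,u_x), G(u,u_x).  Test functions with phi_x = 0 at
    one point of the curve isolate [2 A' = JF = F(A,-A) - F(A,A)], which is minus
    the integral of f^+(A,.) over (-A,A); if this vanishes identically, A is
    constant.  Conversely the autonomous equation for A is solved near a value
    where its right-hand side is nonzero by inverting
    [A |-> t = int dA / A'], and X is then a quadrature.  The representation of f
    is the fundamental theorem of calculus for [Ftilde], combined with [d/dv (v Ftilde) = f^+]. *)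
Require Import Defs.
From Stdlib Require Import Reals Factorial Lra Classical.
From Coquelicot Require Import Coquelicot.
Open Scope R_scope.

(** * Bump functions *)

(** Since [f] is only continuous in u, the amplitude equation has a right-hand side that is merely
    continuous in A, so no Lipschitz argument is available; what makes separation of variables work
    is that the right-hand side stays away from zero. The jumps in the weak form are existentially
    quantified and are pinned down by uniqueness of one-sided limits. Test functions need all mixed
    derivatives, hence an explicit bump built from exp(-1/x); its symmetry gives the vanishing
    derivative at the centre. The value a = 0 is special throughout: the integral over (-a,a) is
    then zero whatever f_0(0) is. So a non-zero integral forces a non-zero starting amplitude, while
    f_0(0) <> 0 has to be transported to a nearby a by continuity. *)

Definition flat (k : nat) (x : R) : R :=
  if Rlt_dec 0 x then (/ x) ^ k * exp (- / x) else 0.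

Lemma flat_nonpos (k : nat) (x : R) : x <= 0 -> flat k x = 0.
Proof. intros Hx. unfold flat. destruct (Rlt_dec 0 x); lra. Qed.

Lemma flat_pos (k : nat) (x : R) : 0 < x -> 0 < flat k x.
Proof.
  intros Hx. unfold flat. destruct (Rlt_dec 0 x) as [_|]; [|lra].
  apply Rmult_lt_0_compat; [apply pow_lt, Rinv_0_lt_compat, Hx | apply exp_pos].
Qed.

Lemma flat_nonneg (k : nat) (x : R) : 0 <= flat k x.
Proof.
  destruct (Rlt_le_dec 0 x) as [Hx|Hx].
  - now apply Rlt_le, flat_pos.
  - rewrite flat_nonpos by exact Hx. lra.
Qed.

(** A single term of the exponential series is at most the sum, all terms being non-negative. *)
Lemma pow_le_fact_exp (n : nat) (y : R) : 0 <= y -> y ^ n <= INR (fact n) * exp y.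
Proof.
  intros Hy. pose proof (INR_fact_lt_0 n) as Hf.
  apply Rmult_le_reg_l with (/ INR (fact n)); [now apply Rinv_0_lt_compat|].
  rewrite <- Rmult_assoc, Rinv_l, Rmult_1_l by lra.
  apply Rle_trans with (2 := exp_ge_taylor y n Hy).
  destruct n as [|n]; simpl sum_f_R0; [simpl; lra|].
  assert (0 <= sum_f_R0 (fun k => y ^ k / INR (fact k)) n).
  { apply cond_pos_sum. intros k. apply Rmult_le_pos; [now apply pow_le|].
    apply Rlt_le, Rinv_0_lt_compat, INR_fact_lt_0. }
  unfold Rdiv in *. rewrite (Rmult_comm (/ _)). simpl in *. lra.
Qed.

(** Put y = 1/x in y^(k+2) <= (k+2)! exp y. Order two at 0 is enough to make the difference quotient
    there tend to 0. *)
Lemma flat_le_sqr (k : nat) (x : R) : flat k x <= INR (fact (k + 2)) * x ^ 2.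
Proof.
  destruct (Rlt_le_dec 0 x) as [Hx|Hx].
  2: { rewrite flat_nonpos by exact Hx.
       apply Rmult_le_pos; [apply Rlt_le, INR_fact_lt_0 | apply pow2_ge_0]. }
  unfold flat. destruct (Rlt_dec 0 x) as [_|]; [|lra].
  pose proof (Rinv_0_lt_compat x Hx) as Hy.
  pose proof (pow_le_fact_exp (k + 2) (/ x) (Rlt_le _ _ Hy)) as H.
  rewrite exp_Ropp. pose proof (exp_pos (/ x)) as He.
  apply Rmult_le_reg_r with (exp (/ x) * (/ x) ^ 2).
  { apply Rmult_lt_0_compat; [exact He | now apply pow_lt]. }
  rewrite pow_add in H.
  replace ((/ x) ^ k * / exp (/ x) * (exp (/ x) * (/ x) ^ 2)) with ((/ x) ^ k * (/ x) ^ 2)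
    by (field; lra).
  replace (INR (fact (k + 2)) * x ^ 2 * (exp (/ x) * (/ x) ^ 2))
    with (INR (fact (k + 2)) * exp (/ x)) by (field; lra).
  exact H.
Qed.

Lemma is_derive_of_quadratic_bound (h : R -> R) (c C : R) :
  (forall x, Rabs (h x - h c) <= C * (x - c) ^ 2) -> is_derive h c 0.
Proof.
  intros H. apply is_derive_Reals. intros eps Heps.
  assert (HC : 0 <= C).
  { specialize (H (c + 1)). pose proof (Rabs_pos (h (c + 1) - h c)). nra. }
  (* [C] may be zero, so the radius is taken with C + 1. *)
  assert (Hd : 0 < eps / (C + 1)) by (apply Rdiv_lt_0_compat; lra).
  exists (mkposreal _ Hd). intros e He He'. simpl in He'.
  specialize (H (c + e)). replace (c + e - c) with e in H by ring.
  rewrite Rminus_0_r. unfold Rdiv. rewrite Rabs_mult, Rabs_inv.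
  pose proof (Rabs_pos_lt e He) as Hp.
  apply Rle_lt_trans with (C * Rabs e).
  - apply Rmult_le_reg_r with (Rabs e); [exact Hp|].
    rewrite Rmult_assoc, Rinv_l by lra.
    rewrite <- (pow2_abs e) in H. lra.
  - apply Rmult_lt_compat_r with (r := C + 1) in He'; [|lra].
    unfold Rdiv in He'. rewrite Rmult_assoc, Rinv_l in He' by lra. nra.
Qed.

(** Differentiating x^(-k) exp(-1/x) only raises the power of 1/x, so the family [flat] is stable up
    to linear combinations; at 0 the quadratic bound gives derivative 0. *)
Lemma is_derive_flat (k : nat) (x : R) :
  is_derive (flat k) x (flat (k + 2) x - INR k * flat (k + 1) x).
Proof.
  destruct (Rtotal_order x 0) as [Hx|[->|Hx]].
  - rewrite !flat_nonpos by lra. replace (0 - _) with 0 by ring.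
    apply is_derive_ext_loc with (fun _ => 0); [|auto_derive; [trivial|reflexivity]].
    apply filter_imp with (fun y => y < 0); [|now apply open_lt].
    intros y Hy. rewrite flat_nonpos; lra.
  - rewrite !flat_nonpos by lra. replace (0 - _) with 0 by ring.
    apply is_derive_of_quadratic_bound with (INR (fact (k + 2))).
    intros y. rewrite (flat_nonpos k 0), !Rminus_0_r by lra.
    rewrite Rabs_pos_eq by apply flat_nonneg. apply flat_le_sqr.
  - apply is_derive_ext_loc with (fun y => (/ y) ^ k * exp (- / y)).
    + apply filter_imp with (fun y => 0 < y); [|now apply open_gt].
      intros y Hy. unfold flat. destruct (Rlt_dec 0 y); lra.
    + unfold flat. destruct (Rlt_dec 0 x) as [_|]; [|lra].
      auto_derive; [lra|]. rewrite !pow_add.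
      (* The derivative of the power contains [pred k], which simplifies only after this case
         split. *)
      destruct k as [|k]; [simpl; field; lra|].
      rewrite S_INR. simpl pred. simpl pow. field. lra.
Qed.

(* The span of these products is stable under differentiation, which gives all
   derivatives of the bump function at once. *)
Inductive flat_span : (R -> R) -> Prop :=
| flat_span_prod i k : flat_span (fun x => flat i (1 + x) * flat k (1 - x))
| flat_span_plus f g : flat_span f -> flat_span g -> flat_span (fun x => f x + g x)
| flat_span_scal c f : flat_span f -> flat_span (fun x => c * f x).

Lemma flat_span_derive (f : R -> R) :
  flat_span f -> exists g, flat_span g /\ forall x, is_derive f x (g x).
Proof.
  induction 1 as [i k | f1 f2 _ [g1 [S1 D1]] _ [g2 [S2 D2]] | c f1 _ [g1 [S1 D1]]].
  - exists (fun x =>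
      (flat (i + 2) (1 + x) * flat k (1 - x)
       + (- INR i) * (flat (i + 1) (1 + x) * flat k (1 - x)))
      + ((-1) * (flat i (1 + x) * flat (k + 2) (1 - x))
       + INR k * (flat i (1 + x) * flat (k + 1) (1 - x)))).
    split.
    { repeat first [apply (flat_span_prod _ _) | apply flat_span_plus
                   | apply flat_span_scal]. }
    intros x.
    assert (Hl : is_derive (fun y => flat i (1 + y)) x
              (flat (i + 2) (1 + x) - INR i * flat (i + 1) (1 + x))).
    { replace (flat (i + 2) (1 + x) - INR i * flat (i + 1) (1 + x))
        with (scal 1 (flat (i + 2) (1 + x) - INR i * flat (i + 1) (1 + x))) by apply Rmult_1_l.
      apply (is_derive_comp (flat i) (fun y => 1 + y)); [apply is_derive_flat|].
      auto_derive; [trivial | ring]. }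
    assert (Hr : is_derive (fun y => flat k (1 - y)) x
              (- (flat (k + 2) (1 - x) - INR k * flat (k + 1) (1 - x)))).
    { replace (- (flat (k + 2) (1 - x) - INR k * flat (k + 1) (1 - x)))
        with (scal (-1) (flat (k + 2) (1 - x) - INR k * flat (k + 1) (1 - x)))
        by (unfold scal; simpl; unfold mult; simpl; ring).
      apply (is_derive_comp (flat k) (fun y => 1 - y)); [apply is_derive_flat|].
      auto_derive; [trivial | ring]. }
    evar_last; [apply (is_derive_mult _ _ x _ _ Hl Hr); intros; apply Rmult_comm|].
    unfold plus, mult; simpl. ring.
  - exists (fun x => g1 x + g2 x). split; [now apply flat_span_plus|].
    intros x. apply (is_derive_plus f1 f2); auto.
  - exists (fun x => c * g1 x). split; [now apply flat_span_scal|].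
    intros x. apply (is_derive_scal f1); auto.
Qed.

Definition smooth_1d (b : R -> R) : Prop := forall n x, ex_derive_n b n x.

Lemma smooth_1d_is_derive (b : R -> R) (n : nat) (x : R) :
  smooth_1d b -> is_derive (Derive_n b n) x (Derive_n b (S n) x).
Proof. intros Hb. apply Derive_correct. exact (Hb (S n) x). Qed.

Lemma flat_span_smooth (f : R -> R) : flat_span f -> smooth_1d f.
Proof.
  intros Hf.
  assert (H : forall n, exists g, flat_span g /\ forall x, Derive_n f n x = g x).
  { induction n as [|n [g [Sg Hg]]]; [now exists f|].
    destruct (flat_span_derive g Sg) as [g' [Sg' Hg']].
    exists g'. split; [exact Sg'|]. intros x. simpl.
    rewrite (Derive_ext _ g x Hg). now apply is_derive_unique. }
  intros [|n] x; [exact I|]. destruct (H n) as [g [Sg Hg]].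
  destruct (flat_span_derive g Sg) as [g' [_ Hg']].
  exists (g' x). apply is_derive_ext with g; [now intros; rewrite Hg | apply Hg'].
Qed.

(** The critical point at the centre is what later removes the phi_x term at the peak. *)
Lemma exists_bump (c r : R) : 0 < r -> exists b : R -> R,
  smooth_1d b /\ Derive b c = 0 /\
  (forall x, Rabs (x - c) < r -> 0 < b x) /\
  (forall x, r <= Rabs (x - c) -> b x = 0).
Proof.
  intros Hr. set (b0 := fun x => flat 0 (1 + x) * flat 0 (1 - x)).
  assert (S0 : smooth_1d b0) by apply flat_span_smooth, flat_span_prod.
  set (b := fun x => b0 (/ r * (x + (- c)))).
  assert (Sb : smooth_1d b).
  { intros n x. apply (ex_derive_n_comp_trans (fun y => b0 (/ r * y))).
    apply ex_derive_n_comp_scal. apply filter_forall. intros y k _. apply S0. }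
  exists b. split; [exact Sb|]. split; [|split].
  - assert (Hs : forall x, b (2 * c + - x) = b x).
    { intros x. unfold b, b0. rewrite Rmult_comm. f_equal; f_equal; ring. }
    pose proof (smooth_1d_is_derive b 0 c Sb) as Hd. simpl in Hd.
    assert (Hd' : is_derive (fun x => b (2 * c + - x)) c (- Derive b c)).
    { replace (- Derive b c) with (scal (-1) (Derive b c))
        by (unfold scal; simpl; unfold mult; simpl; ring).
      apply (is_derive_comp b (fun y => 2 * c + - y)).
      - replace (2 * c + - c) with c by ring. exact Hd.
      - auto_derive; [trivial | ring]. }
    assert (Hd2 : is_derive b c (- Derive b c)) by (now apply is_derive_ext with (2 := Hd')).
    apply is_derive_unique in Hd2. lra.
  - intros x Hx. apply Rabs_def2 in Hx. unfold b, b0.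
    assert (-1 < / r * (x + - c) < 1).
    { pose proof (Rinv_0_lt_compat r Hr). split.
      - replace (-1) with (/ r * (- r)) by (field; lra). apply Rmult_lt_compat_l; lra.
      - replace 1 with (/ r * r) by (field; lra). apply Rmult_lt_compat_l; lra. }
    apply Rmult_lt_0_compat; apply flat_pos; lra.
  - intros x Hx. unfold b, b0. pose proof (Rinv_0_lt_compat r Hr).
    unfold Rabs in Hx. destruct (Rcase_abs (x - c)).
    + rewrite (flat_nonpos 0 (1 + _)); [ring|].
      assert (/ r * (x + - c) <= / r * (- r)) by (apply Rmult_le_compat_l; lra).
      replace (/ r * (- r)) with (-1) in * by (field; lra). lra.
    + rewrite (flat_nonpos 0 (1 - _)); [ring|].
      assert (/ r * r <= / r * (x + - c)) by (apply Rmult_le_compat_l; lra).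
      replace (/ r * r) with 1 in * by (field; lra). lra.
Qed.

Lemma smooth_tensor (b1 b2 : R -> R) :
  smooth_1d b1 -> smooth_1d b2 -> smooth (fun x t => b1 x * b2 t).
Proof.
  intros H1 H2. exists (fun i j x t => Derive_n b1 i x * Derive_n b2 j t).
  split; [reflexivity|]. intros i j x t. split; [|split].
  - apply is_derive_ext with (fun y => Derive_n b2 j t * Derive_n b1 i y);
      [intros; apply Rmult_comm|].
    rewrite Rmult_comm. now apply is_derive_scal, smooth_1d_is_derive.
  - now apply is_derive_scal, smooth_1d_is_derive.
  - assert (Hc : forall b k y, smooth_1d b -> continuity_pt (Derive_n b k) y).
    { intros b k y Hb. apply continuity_pt_filterlim. apply (ex_derive_continuous (Derive_n b k)).
      eexists. now apply smooth_1d_is_derive. }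
    apply continuity_2d_pt_mult.
    + apply (continuity_1d_2d_pt_comp (Derive_n b1 i) (fun u _ => u));
        [now apply Hc | apply continuity_2d_pt_id1].
    + apply (continuity_1d_2d_pt_comp (Derive_n b2 j) (fun _ v => v));
        [now apply Hc | apply continuity_2d_pt_id2].
Qed.

(** * Peakons and the peak kernel *)

Lemma is_derive_continuous (h : R -> R) (x l : R) : is_derive h x l -> continuous h x.
Proof. intros H. apply (ex_derive_continuous h). now exists l. Qed.

Lemma continuity_2d_pt_comp (h p q : R -> R -> R) (x y : R) :
  continuity_2d_pt h (p x y) (q x y) -> continuity_2d_pt p x y -> continuity_2d_pt q x y ->
  continuity_2d_pt (fun u v => h (p u v) (q u v)) x y.
Proof.
  rewrite !continuity_2d_pt_filterlim. intros Hh Hp Hq.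
  exact (continuous_comp_2 (fun z : R * R => p (fst z) (snd z))
           (fun z : R * R => q (fst z) (snd z)) h (x, y) Hp Hq Hh).
Qed.

Lemma continuous_along_curve (h : R -> R -> R) (p q : R -> R) (t : R) :
  continuity_2d_pt h (p t) (q t) -> continuous p t -> continuous q t ->
  continuous (fun s => h (p s) (q s)) t.
Proof.
  rewrite continuity_2d_pt_filterlim. intros Hh Hp Hq.
  exact (continuous_comp_2 p q h t Hp Hq Hh).
Qed.

Lemma continuous_partial (h : R -> R -> R) (u v : R) :
  continuity_2d_pt h u v -> continuous (h u) v.
Proof.
  intros H. apply (continuous_along_curve h (fun _ => u) (fun s => s));
    [exact H | apply continuous_const | apply continuous_id].
Qed.

Lemma continuous_RInt_param (h : R -> R -> R) (a b u : R) :
  a <= b -> (forall v s, continuity_2d_pt h v s) ->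
  continuous (fun v => RInt (h v) a b) u.
Proof.
  intros Hab Hh.
  assert (Hex : forall v, ex_RInt (h v) a b).
  { intros v. apply (ex_RInt_continuous (V := R_CompleteNormedModule)).
    intros s _. apply continuous_partial, Hh. }
  apply filterlim_locally. intros eps.
  (* The added 1 covers the case a = b and leaves room for a strict inequality. *)
  assert (He : 0 < eps / (b - a + 1)).
  { apply Rdiv_lt_0_compat; [apply cond_pos | lra]. }
  destruct (uniform_continuity_2d_1d' h a b u (fun s _ => Hh u s) (mkposreal _ He))
    as [d Hd]. simpl in Hd.
  exists d. intros v Hv. change (Rabs (v - u) < d) in Hv.
  change (Rabs (RInt (h v) a b - RInt (h u) a b) < eps).
  apply Rabs_def2 in Hv. pose proof (cond_pos d) as Hd0.
  replace (RInt (h v) a b - RInt (h u) a b) with (RInt (fun s => h v s - h u s) a b)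
    by (apply (RInt_minus (V := R_CompleteNormedModule)); apply Hex).
  apply Rle_lt_trans with ((b - a) * (eps / (b - a + 1))).
  - apply abs_RInt_le_const; [exact Hab | now apply (@ex_RInt_minus R_NormedModule)|].
    intros s Hs. apply Rlt_le. apply (Hd s u s v); try lra.
    rewrite Rminus_diag, Rabs_R0. exact Hd0.
  - pose proof (cond_pos eps).
    replace (pos eps) with ((b - a + 1) * (eps / (b - a + 1))) at 2 by (field; lra).
    apply Rmult_lt_compat_r; lra.
Qed.

(** For k = 1 and k = -1 these are the values of the antiderivative on the two sides of a peak,
    where u_x = u and u_x = -u. *)
Lemma continuous_antider_ray (h : R -> R -> R) (k u : R) :
  (forall v s, continuity_2d_pt h v s) -> continuous (fun v => antider h v (k * v)) u.
Proof.
  intros Hh.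
  (* Rescaling to [0,1] moves the parameter from the endpoint into the integrand. *)
  apply continuous_ext with (fun v => RInt (fun s => k * v * h v (k * v * s + 0)) 0 1).
  { intros v. unfold antider.
    pose proof (RInt_comp_lin (h v) (k * v) 0 0 1) as H.
    rewrite !Rmult_0_r, Rmult_1_r, !Rplus_0_r in H. apply H.
    apply (ex_RInt_continuous (V := R_CompleteNormedModule)).
    intros s _. apply continuous_partial, Hh. }
  apply continuous_RInt_param; [lra|]. intros v s.
  assert (Hkv : continuity_2d_pt (fun w _ => k * w) v s).
  { apply continuity_2d_pt_mult; [apply continuity_2d_pt_const | apply continuity_2d_pt_id1]. }
  apply continuity_2d_pt_mult; [exact Hkv|].
  apply (continuity_2d_pt_comp h (fun w _ => w) (fun w y => k * w * y + 0));
    [apply Hh | apply continuity_2d_pt_id1|].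
  apply continuity_2d_pt_plus; [|apply continuity_2d_pt_const].
  apply continuity_2d_pt_mult; [exact Hkv | apply continuity_2d_pt_id2].
Qed.

Lemma is_derive_peakon_right (A X : R -> R) (x t : R) : X t < x ->
  is_derive (fun y => peakon A X y t) x (- peakon A X x t).
Proof.
  intros Hx. unfold peakon.
  apply is_derive_ext_loc with (fun y => A t * exp (- (y - X t))).
  - apply filter_imp with (fun y => X t < y); [|now apply open_gt].
    intros y Hy. rewrite Rabs_pos_eq; [reflexivity | lra].
  - rewrite Rabs_pos_eq by lra. auto_derive; [trivial|]. unfold Rminus. ring.
Qed.

Lemma is_derive_peakon_left (A X : R -> R) (x t : R) : x < X t ->
  is_derive (fun y => peakon A X y t) x (peakon A X x t).
Proof.
  intros Hx. unfold peakon.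
  apply is_derive_ext_loc with (fun y => A t * exp (y - X t)).
  - apply filter_imp with (fun y => y < X t); [|now apply open_lt].
    intros y Hy. rewrite Rabs_left by lra. do 2 f_equal. ring.
  - rewrite Rabs_left, Ropp_involutive by lra. auto_derive; [trivial|]. unfold Rminus. ring.
Qed.

(** Each side of the peak is a multiple of exp(x) or exp(-x). Hence u - u_xx vanishes off the curve,
    which removes the classical f and g terms from the weak form. *)
Lemma peakon_dxx (A X : R -> R) (x t : R) : x <> X t ->
  dx (dx (peakon A X)) x t = peakon A X x t.
Proof.
  intros Hx. unfold dx at 1. apply is_derive_unique.
  destruct (Rtotal_order x (X t)) as [Hl|[He|Hr]]; [|lra|].
  - apply is_derive_ext_loc with (fun y => peakon A X y t);
      [|now apply is_derive_peakon_left].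
    apply filter_imp with (fun y => y < X t); [|now apply open_lt].
    intros y Hy. symmetry. now apply is_derive_unique, is_derive_peakon_left.
  - apply is_derive_ext_loc with (fun y => - peakon A X y t).
    + apply filter_imp with (fun y => X t < y); [|now apply open_gt].
      intros y Hy. symmetry. now apply is_derive_unique, is_derive_peakon_right.
    + rewrite <- (Ropp_involutive (peakon A X x t)).
      apply (is_derive_opp (fun y => peakon A X y t)). now apply is_derive_peakon_right.
Qed.

Lemma continuous_peakon (A X : R -> R) (x t : R) : continuous (fun y => peakon A X y t) x.
Proof.
  apply (continuous_comp (fun y => - Rabs (y - X t)) (fun z => A t * exp z)).
  - apply (continuous_opp (V := R_NormedModule) (fun y => Rabs (y - X t))).
    apply (continuous_comp (fun y => y - X t) Rabs); [|apply continuous_Rabs].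
    apply (continuous_minus (V := R_NormedModule) (fun y => y) (fun _ => X t));
      [apply continuous_id | apply continuous_const].
  - eapply is_derive_continuous. auto_derive; [trivial | reflexivity].
Qed.

(** Left of the peak u_x = u and right of it u_x = -u, so both one-sided limits are limits along
    rays through the origin, evaluated at u = A. *)
Lemma peakon_jump (h : R -> R -> R) (A X : R -> R) (t : R) :
  (forall u v, continuity_2d_pt h u v) ->
  is_jump (fun x => antider h (peakon A X x t) (dx (peakon A X) x t)) (X t)
    (antider h (A t) (- A t) - antider h (A t) (A t)).
Proof.
  intros Hh.
  assert (Hp : peakon A X (X t) t = A t).
  { unfold peakon. rewrite Rminus_diag, Rabs_R0, Ropp_0, exp_0. ring. }
  assert (Hray : forall k, filterlim (fun x => antider h (peakon A X x t) (k * peakon A X x t))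
             (locally (X t)) (locally (antider h (A t) (k * A t)))).
  { intros k. rewrite <- Hp.
    apply (continuous_comp (fun x => peakon A X x t) (fun v => antider h v (k * v)));
      [apply continuous_peakon | now apply continuous_antider_ray]. }
  exists (antider h (A t) (A t)), (antider h (A t) (- A t)). repeat split.
  - refine (filterlim_within_ext (fun x => x < X t)
             (fun x => antider h (peakon A X x t) (1 * peakon A X x t)) _ _ _).
    + intros x Hx. rewrite Rmult_1_l. f_equal. symmetry.
      now apply is_derive_unique, is_derive_peakon_left.
    + refine (filterlim_filter_le_1 _ (filter_le_within _) _).
      rewrite <- (Rmult_1_l (A t)) at 2. apply Hray.
  - refine (filterlim_within_ext (fun x => x > X t)
             (fun x => antider h (peakon A X x t) (-1 * peakon A X x t)) _ _ _).
    + intros x Hx. replace (-1 * _) with (- peakon A X x t) by ring. f_equal. symmetry.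
      now apply is_derive_unique, is_derive_peakon_right.
    + refine (filterlim_filter_le_1 _ (filter_le_within _) _).
      replace (- A t) with (-1 * A t) by ring. apply Hray.
Qed.

Lemma is_jump_unique (h : R -> R) (c j1 j2 : R) : is_jump h c j1 -> is_jump h c j2 -> j1 = j2.
Proof.
  intros [l1 [r1 [Hl1 [Hr1 ->]]]] [l2 [r2 [Hl2 [Hr2 ->]]]].
  rewrite (filterlim_locally_unique h l1 l2 Hl1 Hl2).
  now rewrite (filterlim_locally_unique h r1 r2 Hr1 Hr2).
Qed.

Lemma is_derive_zero_outside (p p1 : R -> R) (xa xb : R) :
  (forall x, is_derive p x (p1 x)) -> (forall x, x < xa \/ xb < x -> p x = 0) ->
  forall x, x < xa \/ xb < x -> p1 x = 0.
Proof.
  intros Hd Hz x Hx. rewrite <- (is_derive_unique p x (p1 x) (Hd x)).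
  apply is_derive_unique, is_derive_ext_loc with (fun _ => 0);
    [|auto_derive; [trivial | reflexivity]].
  destruct Hx as [Hx|Hx].
  - apply filter_imp with (fun y => y < xa); [|now apply open_lt].
    intros y Hy. symmetry. apply Hz. now left.
  - apply filter_imp with (fun y => xb < y); [|now apply open_gt].
    intros y Hy. symmetry. apply Hz. now right.
Qed.

(** A support condition on a closed interval says nothing at its endpoints; continuity supplies the
    zero boundary terms for integration by parts. *)
Lemma continuous_zero_outside (p : R -> R) (xa xb : R) :
  (forall x, continuous p x) -> (forall x, x < xa \/ xb < x -> p x = 0) ->
  forall x, x <= xa \/ xb <= x -> p x = 0.
Proof.
  intros Hc Hz x [[Hx | ->] | [Hx | <-]]; [now apply Hz; left | | now apply Hz; right |].
  - apply (filterlim_locally_unique (F := at_left xa) p).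
    + exact (filterlim_filter_le_1 _ (filter_le_within _) (Hc xa)).
    + refine (filterlim_within_ext (fun y => y < xa) (fun _ => 0) _ _ (filterlim_const _)).
      intros y Hy. symmetry. apply Hz. now left.
  - apply (filterlim_locally_unique (F := at_right xb) p).
    + exact (filterlim_filter_le_1 _ (filter_le_within _) (Hc xb)).
    + refine (filterlim_within_ext (fun y => y > xb) (fun _ => 0) _ _ (filterlim_const _)).
      intros y Hy. symmetry. apply Hz. now right.
Qed.

Lemma is_RInt_zero_on (h : R -> R) (a b : R) :
  (forall x, Rmin a b < x < Rmax a b -> h x = 0) -> is_RInt h a b 0.
Proof.
  intros H. apply is_RInt_ext with (fun _ => 0); [intros; symmetry; now apply H|].
  evar_last; [apply (@is_RInt_const R_NormedModule)|]. unfold scal; simpl; unfold mult; simpl. ring.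
Qed.

(* [exp (- |x - c|) / 2] is the fundamental solution of [1 - d^2/dx^2]. *)
Lemma is_RInt_peak_kernel (p p1 p2 : R -> R) (c xa xb : R) :
  (forall x, is_derive p x (p1 x)) -> (forall x, is_derive p1 x (p2 x)) ->
  (forall x, continuous p2 x) -> (forall x, x < xa \/ xb < x -> p x = 0) ->
  is_RInt (fun x => exp (- Rabs (x - c)) * (p x - p2 x)) xa xb (2 * p c).
Proof.
  intros D0 D1 C2 Z.
  pose proof (is_derive_zero_outside p p1 xa xb D0 Z) as Z1.
  pose proof (is_derive_zero_outside p1 p2 xa xb D1 Z1) as Z2.
  assert (C0 : forall x, continuous p x) by (intros x; eapply is_derive_continuous, D0).
  assert (C1 : forall x, continuous p1 x) by (intros x; eapply is_derive_continuous, D1).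
  pose proof (continuous_zero_outside p xa xb C0 Z) as Z'.
  pose proof (continuous_zero_outside p1 xa xb C1 Z1) as Z1'.
  assert (Hc : forall k x, continuous (fun y => exp (k * (y - c)) * (p y - p2 y)) x).
  { intros k x. apply (continuous_mult (K := R_AbsRing)
             (fun y => exp (k * (y - c))) (fun y => p y - p2 y)).
    - eapply is_derive_continuous. auto_derive; [trivial | reflexivity].
    - apply (continuous_minus (V := R_NormedModule) p p2); auto. }
  assert (HL : is_RInt (fun x => exp (- Rabs (x - c)) * (p x - p2 x)) xa c (p c - p1 c)).
  { destruct (Rlt_le_dec c xa) as [Hlt|Hle].
    - rewrite (Z c), (Z1 c), Rminus_diag by now left. apply is_RInt_zero_on.
      intros x. rewrite Rmin_right, Rmax_left by lra. intros Hx.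
      rewrite (Z x), (Z2 x) by (left; lra). ring.
    - apply is_RInt_ext with (fun x => exp (1 * (x - c)) * (p x - p2 x)).
      + intros x. rewrite Rmin_left, Rmax_right by lra. intros Hx.
        rewrite Rabs_left by lra. do 2 f_equal. ring.
      + evar_last.
        (* In the derivative of exp(x - c) (p - p') the terms in p' cancel, leaving exp(x - c) (p -
           p''). *)
        { apply (is_RInt_derive (V := R_CompleteNormedModule)
                   (fun x => exp (1 * (x - c)) * (p x - p1 x)));
            [|intros; apply Hc].
          intros x _. auto_derive; [split; [now eexists|split; [now eexists|trivial]]|].
          change (Derive (fun y => p y) x) with (Derive p x).
          change (Derive (fun y => p1 y) x) with (Derive p1 x).
          rewrite (is_derive_unique _ _ _ (D0 x)), (is_derive_unique _ _ _ (D1 x)).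
          unfold Rminus. ring. }
        unfold minus, plus, opp; simpl.
        rewrite (Z' xa), (Z1' xa) by (left; lra).
        rewrite Rminus_diag, Rmult_0_r, exp_0. ring. }
  assert (HR : is_RInt (fun x => exp (- Rabs (x - c)) * (p x - p2 x)) c xb (p c + p1 c)).
  { destruct (Rlt_le_dec xb c) as [Hlt|Hle].
    - rewrite (Z c), (Z1 c), Rplus_0_r by now right. apply is_RInt_zero_on.
      intros x. rewrite Rmin_right, Rmax_left by lra. intros Hx.
      rewrite (Z x), (Z2 x) by (right; lra). ring.
    - apply is_RInt_ext with (fun x => exp (-1 * (x - c)) * (p x - p2 x)).
      + intros x. rewrite Rmin_left, Rmax_right by lra. intros Hx.
        rewrite Rabs_pos_eq by lra. do 2 f_equal. ring.
      + evar_last.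
        (* Mirror image: the primitive is - exp(-(x - c)) (p + p'). Adding the two halves cancels p'
           at [c] and doubles p. *)
        { apply (is_RInt_derive (V := R_CompleteNormedModule)
                   (fun x => - (exp (-1 * (x - c)) * (p x + p1 x))));
            [|intros; apply Hc].
          intros x _. auto_derive; [split; [now eexists|split; [now eexists|trivial]]|].
          change (Derive (fun y => p y) x) with (Derive p x).
          change (Derive (fun y => p1 y) x) with (Derive p1 x).
          rewrite (is_derive_unique _ _ _ (D0 x)), (is_derive_unique _ _ _ (D1 x)).
          unfold Rminus. ring. }
        unfold minus, plus, opp; simpl.
        rewrite (Z' xb), (Z1' xb) by (right; lra).
        rewrite Rminus_diag, Rmult_0_r, exp_0. ring. }
  evar_last; [apply (is_RInt_Chasles _ _ _ _ _ _ HL HR)|].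
  unfold plus; simpl. ring.
Qed.

(** At the peak [dx] has no meaningful value, so integrands are compared only off one point.
    Splitting there makes it an endpoint, where [is_RInt_ext] asks for nothing. *)
Lemma is_RInt_ext_except (h1 h2 : R -> R) (c a b l : R) :
  a <= b -> (forall x, x <> c -> h1 x = h2 x) -> is_RInt h1 a b l -> is_RInt h2 a b l.
Proof.
  intros Hab He Hi.
  assert (Hdec : a < c < b \/ ~ a < c < b) by lra.
  destruct Hdec as [Hc|Hc].
  - assert (E1 : ex_RInt h1 a c).
    { apply (ex_RInt_Chasles_1 (V := R_CompleteNormedModule) h1 a c b); [lra | now exists l]. }
    assert (E2 : ex_RInt h1 c b).
    { apply (ex_RInt_Chasles_2 (V := R_CompleteNormedModule) h1 a c b); [lra | now exists l]. }
    destruct E1 as [l1 H1], E2 as [l2 H2].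
    pose proof (is_RInt_Chasles h1 a c b l1 l2 H1 H2) as H12.
    apply (is_RInt_unique (V := R_CompleteNormedModule)) in Hi, H12.
    rewrite <- Hi, H12.
    apply (is_RInt_Chasles h2 a c b).
    + apply is_RInt_ext with (2 := H1). intros x. rewrite Rmax_right by lra.
      intros Hx. apply He. lra.
    + apply is_RInt_ext with (2 := H2). intros x. rewrite Rmin_left by lra.
      intros Hx. apply He. lra.
  - apply is_RInt_ext with (2 := Hi). intros x. rewrite Rmin_left, Rmax_right by lra.
    intros Hx. apply He. intros ->. tauto.
Qed.

(** * The weak form along the peak *)

Lemma smooth_dx (phi : R -> R -> R) : smooth phi -> smooth (dx phi).
Proof.
  intros [D [D0 HD]]. exists (fun i j => D (S i) j). split; [|intros; apply HD].
  intros x t. symmetry. apply is_derive_unique.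
  apply is_derive_ext with (fun y => D 0%nat 0%nat y t); [intros; apply D0 | apply HD].
Qed.

Lemma smooth_dt (phi : R -> R -> R) : smooth phi -> smooth (dt phi).
Proof.
  intros [D [D0 HD]]. exists (fun i j => D i (S j)). split; [|intros; apply HD].
  intros x t. symmetry. apply is_derive_unique.
  apply is_derive_ext with (fun s => D 0%nat 0%nat x s); [intros; apply D0 | apply HD].
Qed.

Lemma smooth_is_derive_x (phi : R -> R -> R) (x t : R) :
  smooth phi -> is_derive (fun y => phi y t) x (dx phi x t).
Proof.
  intros [D [D0 HD]]. apply Derive_correct. exists (D 1%nat 0%nat x t).
  apply is_derive_ext with (fun y => D 0%nat 0%nat y t); [intros; apply D0 | apply HD].
Qed.

Lemma smooth_is_derive_t (phi : R -> R -> R) (x t : R) :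
  smooth phi -> is_derive (fun s => phi x s) t (dt phi x t).
Proof.
  intros [D [D0 HD]]. apply Derive_correct. exists (D 0%nat 1%nat x t).
  apply is_derive_ext with (fun s => D 0%nat 0%nat x s); [intros; apply D0 | apply HD].
Qed.

Lemma smooth_continuity_2d (phi : R -> R -> R) (x t : R) :
  smooth phi -> continuity_2d_pt phi x t.
Proof.
  intros [D [D0 HD]].
  apply continuity_2d_pt_ext with (D 0%nat 0%nat); [intros; apply D0 | apply HD].
Qed.

Lemma continuous_smooth_curve (phi : R -> R -> R) (X : R -> R) (t : R) :
  smooth phi -> continuous X t -> continuous (fun s => phi (X s) s) t.
Proof.
  intros Hphi HX. apply (continuous_along_curve phi X (fun s => s));
    [now apply smooth_continuity_2d | exact HX | apply continuous_id].
Qed.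

Lemma is_derive_smooth_curve (phi : R -> R -> R) (X : R -> R) (t X1 : R) :
  smooth phi -> is_derive X t X1 ->
  is_derive (fun s => phi (X s) s) t (dx phi (X t) t * X1 + dt phi (X t) t).
Proof.
  intros Hphi HX.
  rewrite <- (Rmult_1_r (dt phi (X t) t)). apply is_derive_Reals.
  apply (derivable_pt_lim_comp_2d phi X (fun s => s)).
  - apply filterdiff_differentiable_pt_lim.
    apply (is_derive_filterdiff phi (X t) t (dx phi) (dt phi (X t) t)).
    + apply filter_forall. intros [y s]. now apply smooth_is_derive_x.
    + now apply smooth_is_derive_t.
    + apply (continuity_2d_pt_filterlim (dx phi)).
      now apply smooth_continuity_2d, smooth_dx.
  - now apply is_derive_Reals.
  - apply is_derive_Reals. apply (is_derive_id t).
Qed.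

(** Off the peak u = u_xx, so only the term with phi_t survives, and it is - A times the kernel
    identity applied to phi_t. *)
Lemma is_RInt_peakon_integrand (f g : R -> R -> R) (A X : R -> R) (phi : R -> R -> R)
    (xa xb ta tb t : R) :
  xa <= xb -> smooth phi -> supported_in xa xb ta tb phi ->
  is_RInt (fun x =>
      - peakon A X x t * (dt phi x t - dx (dx (dt phi)) x t)
      + f (peakon A X x t) (dx (peakon A X) x t)
        * (peakon A X x t - dx (dx (peakon A X)) x t) * phi x t
      - g (peakon A X x t) (dx (peakon A X) x t)
        * (peakon A X x t - dx (dx (peakon A X)) x t) * dx phi x t)
    xa xb (- 2 * A t * dt phi (X t) t).
Proof.
  intros Hab Hphi Hsupp.
  pose proof (smooth_dt phi Hphi) as St.
  pose proof (smooth_dx _ St) as Sxt. pose proof (smooth_dx _ Sxt) as Sxxt.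
  assert (Hz : forall x, x < xa \/ xb < x -> dt phi x t = 0).
  { intros x Hx. unfold dt. rewrite (Derive_ext _ (fun _ => 0)); [apply Derive_const|].
    intros s. destruct (Req_dec (phi x s) 0) as [H|H]; [exact H|].
    apply Hsupp in H. lra. }
  assert (HK : is_RInt (fun x => scal (- A t)
            (exp (- Rabs (x - X t)) * (dt phi x t - dx (dx (dt phi)) x t)))
            xa xb (scal (- A t) (2 * dt phi (X t) t))).
  { apply (is_RInt_scal (V := R_NormedModule)).
    apply (is_RInt_peak_kernel (fun x => dt phi x t) (fun x => dx (dt phi) x t)
             (fun x => dx (dx (dt phi)) x t)).
    - intros x. now apply smooth_is_derive_x.
    - intros x. now apply smooth_is_derive_x.
    - intros x. eapply is_derive_continuous. now apply smooth_is_derive_x.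
    - exact Hz. }
  replace (- 2 * A t * dt phi (X t) t) with (scal (- A t) (2 * dt phi (X t) t))
    by (unfold scal; simpl; unfold mult; simpl; ring).
  assert (HE : forall x, x <> X t ->
    scal (- A t) (exp (- Rabs (x - X t)) * (dt phi x t - dx (dx (dt phi)) x t)) =
      - peakon A X x t * (dt phi x t - dx (dx (dt phi)) x t)
      + f (peakon A X x t) (dx (peakon A X) x t)
        * (peakon A X x t - dx (dx (peakon A X)) x t) * phi x t
      - g (peakon A X x t) (dx (peakon A X) x t)
        * (peakon A X x t - dx (dx (peakon A X)) x t) * dx phi x t).
  { intros x Hx. rewrite (peakon_dxx A X x t Hx). unfold peakon, scal; simpl; unfold mult; simpl.
    ring. }
  now apply is_RInt_ext_except with (2 := HE).
Qed.

Lemma in_itv_between (t1 t2 : Rbar) (ta tb t : R) :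
  in_itv t1 t2 ta -> in_itv t1 t2 tb -> ta <= t <= tb -> in_itv t1 t2 t.
Proof.
  unfold in_itv. destruct t1 as [r1| |], t2 as [r2| |]; simpl; intros; try tauto; lra.
Qed.

Lemma in_itv_open (t1 t2 : Rbar) (t : R) : in_itv t1 t2 t -> locally t (in_itv t1 t2).
Proof.
  intros [H1 H2]. apply filter_and; [now apply open_Rbar_gt | now apply open_Rbar_lt].
Qed.

Lemma supported_zero_t (phi : R -> R -> R) (xa xb ta tb x t : R) :
  smooth phi -> supported_in xa xb ta tb phi -> t <= ta \/ tb <= t -> phi x t = 0.
Proof.
  intros Hphi Hsupp. apply (continuous_zero_outside (fun s => phi x s)).
  - intros s. eapply is_derive_continuous. now apply smooth_is_derive_t.
  - intros s Hs. destruct (Req_dec (phi x s) 0) as [H|H]; [exact H|].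
    apply Hsupp in H. lra.
Qed.

(* Integrating by parts in t the term with d phi/dt left by the peak kernel. *)
Lemma weak_form_by_parts (f g : R -> R -> R) (t1 t2 : Rbar) (A X JF JG : R -> R)
    (phi : R -> R -> R) (xa xb ta tb : R) :
  C1_on t1 t2 A -> C1_on t1 t2 X ->
  smooth phi -> xa <= xb -> ta <= tb -> in_itv t1 t2 ta -> in_itv t1 t2 tb ->
  supported_in xa xb ta tb phi ->
  is_RInt (fun t =>
      (2 * Derive A t - JF t) * phi (X t) t
      + (2 * A t * Derive X t + JG t) * dx phi (X t) t) ta tb 0
  <->
  is_RInt (fun t =>
      RInt (fun x =>
          - peakon A X x t * (dt phi x t - dx (dx (dt phi)) x t)
          + f (peakon A X x t) (dx (peakon A X) x t)
            * (peakon A X x t - dx (dx (peakon A X)) x t) * phi x t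
          - g (peakon A X x t) (dx (peakon A X) x t)
            * (peakon A X x t - dx (dx (peakon A X)) x t) * dx phi x t) xa xb
      - JF t * phi (X t) t + JG t * dx phi (X t) t) ta tb 0.
Proof.
  intros HA HX Hphi Hx Ht Ha Hb Hsupp.
  (* This is d/dt of 2 A phi(X(t),t). Its integral vanishes because phi is zero at both end times,
     and adding it exchanges the two integrands. *)
  set (total := fun t => 2 * Derive A t * phi (X t) t
        + 2 * A t * (dx phi (X t) t * Derive X t + dt phi (X t) t)).
  assert (Htotal : is_RInt total ta tb 0).
  { evar_last.
    { apply (is_RInt_derive (V := R_CompleteNormedModule) (fun t => 2 * A t * phi (X t) t)).
      - intros t. rewrite Rmin_left, Rmax_right by lra. intros Hi.
        pose proof (in_itv_between _ _ _ _ _ Ha Hb Hi) as Hin.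
        destruct (HA t Hin) as [DA _]. destruct (HX t Hin) as [DX _].
        apply Derive_correct in DA. apply Derive_correct in DX.
        pose proof (is_derive_smooth_curve phi X t _ Hphi DX) as Dphi.
        pose proof (is_derive_scal A t 2 _ DA) as D2A.
        evar_last; [apply (is_derive_mult (fun t => 2 * A t) _ t _ _ D2A Dphi);
          intros; apply Rmult_comm|].
        reflexivity.
      - intros t. rewrite Rmin_left, Rmax_right by lra. intros Hi.
        pose proof (in_itv_between _ _ _ _ _ Ha Hb Hi) as Hin.
        destruct (HA t Hin) as [DA CA]. destruct (HX t Hin) as [DX CX].
        apply Derive_correct, is_derive_continuous in DA, DX.
        apply (continuous_plus (V := R_NormedModule)).
        + apply (continuous_mult (K := R_AbsRing) (fun t => 2 * Derive A t)).
          * apply (continuous_mult (K := R_AbsRing)); [apply continuous_const | exact CA].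
          * now apply continuous_smooth_curve.
        + apply (continuous_mult (K := R_AbsRing) (fun t => 2 * A t)).
          * apply (continuous_mult (K := R_AbsRing)); [apply continuous_const | exact DA].
          * apply (continuous_plus (V := R_NormedModule)).
            -- apply (continuous_mult (K := R_AbsRing)); [|exact CX].
               now apply continuous_smooth_curve; [apply smooth_dx|].
            -- now apply continuous_smooth_curve; [apply smooth_dt|]. }
    rewrite (supported_zero_t phi xa xb ta tb (X tb) tb Hphi Hsupp) by (right; lra).
    rewrite (supported_zero_t phi xa xb ta tb (X ta) ta Hphi Hsupp) by (left; lra).
    unfold minus, plus, opp; simpl. ring. }
  assert (HE : forall t, ta <= t <= tb -> 
      (2 * Derive A t - JF t) * phi (X t) t
      + (2 * A t * Derive X t + JG t) * dx phi (X t) t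
      = RInt (fun x =>
          - peakon A X x t * (dt phi x t - dx (dx (dt phi)) x t)
          + f (peakon A X x t) (dx (peakon A X) x t)
            * (peakon A X x t - dx (dx (peakon A X)) x t) * phi x t
          - g (peakon A X x t) (dx (peakon A X) x t)
            * (peakon A X x t - dx (dx (peakon A X)) x t) * dx phi x t) xa xb
      - JF t * phi (X t) t + JG t * dx phi (X t) t + total t).
  { intros t _.
    rewrite (is_RInt_unique (V := R_CompleteNormedModule) _ _ _ _
      (is_RInt_peakon_integrand f g A X phi xa xb ta tb t Hx Hphi Hsupp)).
    unfold total. ring. }
  split; intros H.
  - pose proof (is_RInt_minus (V := R_NormedModule) _ _ _ _ _ _ H Htotal) as H'.
    replace 0 with (minus 0 0) by (unfold minus, plus, opp; simpl; ring).
    apply is_RInt_ext with (2 := H'). intros t. rewrite Rmin_left, Rmax_right by lra.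
    intros Hi. rewrite HE by lra. unfold minus, plus, opp; simpl. ring.
  - pose proof (is_RInt_plus (V := R_NormedModule) _ _ _ _ _ _ H Htotal) as H'.
    replace 0 with (plus 0 0) by (unfold plus; simpl; ring).
    apply is_RInt_ext with (2 := H'). intros t. rewrite Rmin_left, Rmax_right by lra.
    intros Hi. rewrite HE by lra. reflexivity.
Qed.

(** * The amplitude equation from product test functions *)

(** Multiplying by the constant [K t0] handles both signs at once: a bump supported where K t0 * K t
    > 0 would give a positive integral. *)
Lemma du_bois_reymond (t1 t2 : Rbar) (K : R -> R) (t0 : R) :
  in_itv t1 t2 t0 -> (forall t, in_itv t1 t2 t -> continuous K t) ->
  (forall (r : R) (psi : R -> R), 0 < r -> in_itv t1 t2 (t0 - r) -> in_itv t1 t2 (t0 + r) ->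
     smooth_1d psi -> (forall t, r <= Rabs (t - t0) -> psi t = 0) ->
     is_RInt (fun t => K t * psi t) (t0 - r) (t0 + r) 0) ->
  K t0 = 0.
Proof.
  intros Hin HK Htest. destruct (Req_dec (K t0) 0) as [H0|H0]; [exact H0|exfalso].
  assert (Hloc : locally t0 (fun t => in_itv t1 t2 t /\ 0 < K t0 * K t)).
  { apply filter_and; [now apply in_itv_open|].
    assert (Hc : continuous (fun t => K t0 * K t) t0).
    { apply (continuous_mult (K := R_AbsRing)); [apply continuous_const | now apply HK]. }
    apply (Hc (fun y => 0 < y)). apply open_gt. nra. }
  destruct Hloc as [d Hd]. pose proof (cond_pos d) as Hd0.
  (* Half the radius keeps the closed support of the bump inside the open ball. *)
  assert (Hball : forall t, Rabs (t - t0) <= d / 2 -> in_itv t1 t2 t /\ 0 < K t0 * K t).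
  { intros t Ht. apply Hd. change (Rabs (t - t0) < d). lra. }
  assert (Hmem : forall t, t0 - d / 2 <= t <= t0 + d / 2 -> in_itv t1 t2 t /\ 0 < K t0 * K t).
  { intros t Ht. apply Hball. apply Rabs_le. lra. }
  destruct (exists_bump t0 (d / 2)) as [psi [Spsi [_ [Ppsi Zpsi]]]]; [lra|].
  assert (Hint : is_RInt (fun t => K t * psi t) (t0 - d / 2) (t0 + d / 2) 0).
  { apply Htest; try (apply Hmem; lra); auto. lra. }
  apply (is_RInt_scal (V := R_NormedModule) _ _ _ (K t0)) in Hint.
  apply (is_RInt_unique (V := R_CompleteNormedModule)) in Hint.
  change (RInt (fun t => K t0 * (K t * psi t)) (t0 - d / 2) (t0 + d / 2) = K t0 * 0) in Hint.
  assert (Hpos : 0 < RInt (fun t => K t0 * (K t * psi t)) (t0 - d / 2) (t0 + d / 2)).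
  { apply RInt_gt_0; [lra| |].
    - intros t Ht.
      rewrite <- Rmult_assoc. apply Rmult_lt_0_compat; [apply Hmem; lra|].
      apply Ppsi, Rabs_def1; lra.
    - intros t Ht. apply (continuous_scal_r (V := R_NormedModule) (K t0) (fun t => K t * psi t)).
      apply (continuous_mult (K := R_AbsRing)).
      + apply HK, Hmem, Ht.
      + eapply is_derive_continuous. apply (smooth_1d_is_derive psi 0 t Spsi). }
  lra.
Qed.

Lemma weak_solution_amplitude (f g : R -> R -> R) (t1 t2 : Rbar) (A X : R -> R) (t0 : R) :
  (forall u v, continuity_2d_pt f u v) -> (forall u v, continuity_2d_pt g u v) ->
  C1_on t1 t2 A -> C1_on t1 t2 X -> weak_solution f g t1 t2 X (peakon A X) ->
  in_itv t1 t2 t0 ->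
  2 * Derive A t0 = antider f (A t0) (- A t0) - antider f (A t0) (A t0).
Proof.
  intros Cf Cg HA HX [JF [JG [HJ Hweak]]] Hin0.
  set (jump := fun (h : R -> R -> R) t => antider h (A t) (- A t) - antider h (A t) (A t)).
  (* The definition of a weak solution only asserts that some jumps exist; uniqueness of limits
     makes them explicit, and thereby continuous in t. *)
  assert (EJ : forall t, in_itv t1 t2 t -> JF t = jump f t /\ JG t = jump g t).
  { intros t Hin. destruct (HJ t Hin) as [J1 J2].
    split; eapply is_jump_unique; eauto; now apply peakon_jump. }
  assert (Cjump : forall h t, (forall u v, continuity_2d_pt h u v) -> in_itv t1 t2 t ->
            continuous (jump h) t).
  { intros h t Ch Hin. destruct (HA t Hin) as [DA _].
    apply Derive_correct, is_derive_continuous in DA.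
    apply (continuous_minus (V := R_NormedModule)
             (fun t => antider h (A t) (- A t)) (fun t => antider h (A t) (A t))).
    - apply continuous_ext with (fun s => antider h (A s) (-1 * A s));
        [intros s; f_equal; ring|].
      apply (continuous_comp A (fun v => antider h v (-1 * v)));
        [exact DA | now apply continuous_antider_ray].
    - apply continuous_ext with (fun s => antider h (A s) (1 * A s));
        [intros s; f_equal; ring|].
      apply (continuous_comp A (fun v => antider h v (1 * v)));
        [exact DA | now apply continuous_antider_ray]. }
  destruct (exists_bump (X t0) 1 Rlt_0_1) as [chi [Schi [Dchi [Pchi Zchi]]]].
  (* With phi = chi(x) psi(t), [chi] fixed and [psi] arbitrary, the reduced weak form is the
     integral of K psi. The second summand of [K] vanishes only at [t0], where chi'(X t0) = 0, and
     that is the one point needed. *)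
  set (K := fun t => (2 * Derive A t - jump f t) * chi (X t)
                     + (2 * A t * Derive X t + jump g t) * Derive chi (X t)).
  assert (HK : K t0 = 0).
  { apply (du_bois_reymond t1 t2); [exact Hin0| |].
    - intros t Hin. destruct (HA t Hin) as [DA CA]. destruct (HX t Hin) as [DX CX].
      apply Derive_correct, is_derive_continuous in DA, DX.
      assert (Cchi : continuous (fun t => chi (X t)) t).
      { apply (continuous_comp X chi); [exact DX|].
        eapply is_derive_continuous, (smooth_1d_is_derive chi 0 _ Schi). }
      assert (Cchi' : continuous (fun t => Derive chi (X t)) t).
      { apply (continuous_comp X (Derive chi)); [exact DX|].
        eapply is_derive_continuous, (smooth_1d_is_derive chi 1 _ Schi). }
      assert (C2 : forall h, continuous h t -> continuous (fun s => 2 * h s) t).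
      { intros h Hh. apply (continuous_mult (K := R_AbsRing)); [apply continuous_const|auto]. }
      apply (continuous_plus (V := R_NormedModule)).
      + apply (continuous_mult (K := R_AbsRing)); [|exact Cchi].
        apply (continuous_minus (V := R_NormedModule)); [now apply C2 | now apply Cjump].
      + apply (continuous_mult (K := R_AbsRing)); [|exact Cchi'].
        apply (continuous_plus (V := R_NormedModule)); [|now apply Cjump].
        apply (continuous_mult (K := R_AbsRing)); [now apply C2 | exact CX].
    - intros r psi Hr Hl Hu Spsi Zpsi.
      set (phi := fun x t => chi x * psi t).
      assert (Sphi : smooth phi) by now apply smooth_tensor.
      assert (Hsupp : supported_in (X t0 - 1) (X t0 + 1) (t0 - r) (t0 + r) phi).
      { intros x t Hne. unfold phi in Hne. split.
        - destruct (Rlt_le_dec (Rabs (x - X t0)) 1) as [H|H].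
          + apply Rabs_def2 in H. lra.
          + rewrite (Zchi x H) in Hne. lra.
        - destruct (Rlt_le_dec (Rabs (t - t0)) r) as [H|H].
          + apply Rabs_def2 in H. lra.
          + rewrite (Zpsi t H) in Hne. lra. }
      assert (Hdx : forall x t, dx phi x t = Derive chi x * psi t).
      { intros x t. unfold dx, phi.
        rewrite (Derive_ext _ (fun y => psi t * chi y)) by (intros; apply Rmult_comm).
        rewrite Derive_scal. apply Rmult_comm. }
      destruct (Hweak phi (X t0 - 1) (X t0 + 1) (t0 - r) (t0 + r)) as [_ Hz];
        try assumption; try lra.
      apply (weak_form_by_parts f g t1 t2) in Hz; try assumption; try lra.
      apply is_RInt_ext with (2 := Hz). intros t. rewrite Rmin_left, Rmax_right by lra.
      intros Ht. destruct (EJ t) as [-> ->];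
        [apply in_itv_between with (t0 - r) (t0 + r); auto; lra|].
      rewrite Hdx. unfold K, phi. apply Rminus_diag_uniq. ring. }
  unfold K in HK. rewrite Dchi in HK.
  assert (0 < chi (X t0)) by (apply Pchi; rewrite Rminus_diag, Rabs_R0; lra).
  assert (H0 : 2 * Derive A t0 - jump f t0 = 0) by nra.
  unfold jump in H0. lra.
Qed.

(** * Representation of f *)

Lemma is_derive_antider (h : R -> R -> R) (u v : R) :
  (forall y, continuous (h u) y) -> is_derive (antider h u) v (h u v).
Proof.
  intros Hc. apply (is_derive_RInt (V := R_NormedModule) (h u) (antider h u) 0); [|apply Hc].
  apply filter_forall. intros y. apply (RInt_correct (V := R_CompleteNormedModule)).
  apply (ex_RInt_continuous (V := R_CompleteNormedModule)). auto.
Qed.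

Lemma is_derive_comp_Ropp (p : R -> R) (x l : R) :
  is_derive p (- x) l -> is_derive (fun y => p (- y)) x (- l).
Proof.
  intros H. replace (- l) with (scal (-1) l)
    by (unfold scal; simpl; unfold mult; simpl; ring).
  apply (is_derive_comp p (fun y => - y)); [exact H|]. auto_derive; [trivial | ring].
Qed.

Lemma is_derive_odd_part (h : R -> R -> R) (u v l m : R) :
  is_derive (h u) v l -> is_derive (h u) (- v) m ->
  is_derive (odd_part h u) v ((l + m) / 2).
Proof.
  intros Hl Hm. apply is_derive_comp_Ropp in Hm.
  apply is_derive_ext with (fun y => / 2 * (h u y - h u (- y)));
    [intros; unfold odd_part, Rdiv; apply Rmult_comm|].
  evar_last; [apply is_derive_scal, (is_derive_minus _ _ _ _ _ Hl Hm)|].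
  unfold minus, plus, opp; simpl. field.
Qed.

Lemma is_derive_even_part (h : R -> R -> R) (u v l m : R) :
  is_derive (h u) v l -> is_derive (h u) (- v) m ->
  is_derive (even_part h u) v ((l - m) / 2).
Proof.
  intros Hl Hm. apply is_derive_comp_Ropp in Hm.
  apply is_derive_ext with (fun y => / 2 * (h u y + h u (- y)));
    [intros; unfold even_part, Rdiv; apply Rmult_comm|].
  evar_last; [apply is_derive_scal, (is_derive_plus _ _ _ _ _ Hl Hm)|].
  unfold plus; simpl. field.
Qed.

Lemma RInt_even_part (h : R -> R -> R) (a : R) : (forall y, continuous (h a) y) ->
  RInt (even_part h a) (- a) a = antider h a a - antider h a (- a).
Proof.
  intros Hc. apply (is_RInt_unique (V := R_CompleteNormedModule)). evar_last.
  (* Differentiation turns the odd part of an antiderivative into the even part of the function. *)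
  - apply (is_RInt_derive (V := R_CompleteNormedModule) (odd_part (antider h) a)).
    + intros y _. apply is_derive_odd_part; now apply is_derive_antider.
    + intros y _. unfold even_part, Rdiv.
      apply (continuous_mult (K := R_AbsRing)); [|apply continuous_const].
      apply (continuous_plus (V := R_NormedModule)); [apply Hc|].
      apply (continuous_comp Ropp (h a)); [|apply Hc].
      apply (continuous_opp (V := R_NormedModule) (fun y => y)), continuous_id.
  - unfold odd_part, minus, plus, opp; simpl. rewrite Ropp_involutive. field.
Qed.

(** The integral is 2 F^-(a,a). The factor [a] hides the value of [f0] at 0. *)
Lemma RInt_even_part_f0 (f : R -> R -> R) (a : R) : (forall y, continuous (f a) y) ->
  RInt (even_part f a) (- a) a = 2 * a * f0 f a.
Proof.
  intros Hc. rewrite RInt_even_part by exact Hc. unfold f0, Ftilde.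
  destruct (Req_EM_T a 0) as [->|Ha].
  - rewrite Ropp_0. apply Rminus_diag_uniq; ring.
  - unfold odd_part. apply Rminus_diag_uniq; field. exact Ha.
Qed.

Lemma mean_value (p p1 : R -> R) (x y : R) : (forall z, is_derive p z (p1 z)) ->
  exists z, Rmin x y <= z <= Rmax x y /\ p y - p x = p1 z * (y - x).
Proof.
  intros Hd. apply (MVT_gen p x y p1); [intros; apply Hd|].
  intros z _. apply continuity_pt_filterlim. apply (is_derive_continuous p z (p1 z)), Hd.
Qed.

(* By two applications of the mean value theorem, T and its derivative are
   controlled near 0 by the values of q1 between 0 and v. *)
Lemma quotient_C1 (q q1 O T : R -> R) :
  (forall v, is_derive O v (q v)) -> (forall v, is_derive q v (q1 v)) ->
  (forall v, continuous q1 v) -> O 0 = 0 -> q1 0 = 0 ->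
  T 0 = q 0 -> (forall v, v <> 0 -> T v = O v / v) ->
  exists T1, forall v,
    is_derive T v (T1 v) /\ continuous T1 v /\ v * T1 v = q v - T v.
Proof.
  intros DO Dq C1 O0 q10 T0 Tv.
  (* For v <> 0, T v = q y for some y between 0 and v, so both differences are increments of q over
     a length at most |v|, with slope q1 below eps near 0. *)
  assert (Hsmall : forall eps : posreal, exists d : posreal, forall v, Rabs v < d ->
            Rabs (T v - T 0) <= eps * Rabs v /\ Rabs (q v - T v) <= eps * Rabs v).
  { intros eps.
    destruct (C1 0 _ (locally_ball (q1 0) eps)) as [d Hd].
    exists d. intros v Hv.
    assert (Hq : forall w z, Rabs w <= Rabs v -> Rabs z <= Rabs v ->
              Rabs (q w - q z) <= eps * Rabs (w - z)).
    { intros w z Hw Hz. destruct (mean_value q q1 z w Dq) as [y [Hy ->]].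
      rewrite Rabs_mult. apply Rmult_le_compat_r; [apply Rabs_pos|].
      apply Rlt_le. rewrite <- (Rminus_0_r (q1 y)), <- q10. apply Hd.
      change (Rabs (y - 0) < d). rewrite Rminus_0_r. apply Rle_lt_trans with (2 := Hv).
      apply Rabs_le. apply Rabs_le_between in Hw, Hz.
      unfold Rmin, Rmax in Hy. destruct (Rle_dec z w); lra. }
    destruct (Req_dec v 0) as [->|Hne].
    { rewrite T0, !Rminus_diag, Rabs_R0. lra. }
    destruct (mean_value O q 0 v DO) as [y [Hy HO]].
    rewrite O0, !Rminus_0_r in HO.
    rewrite (Tv v Hne), HO, T0.
    replace (q y * v / v) with (q y) by (field; exact Hne).
    assert (Hyv : Rabs y <= Rabs v /\ Rabs (y - 0) <= Rabs v /\ Rabs (v - y) <= Rabs v).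
    { unfold Rmin, Rmax in Hy. unfold Rabs.
      destruct (Rle_dec 0 v), (Rcase_abs y), (Rcase_abs v), (Rcase_abs (y - 0)),
        (Rcase_abs (v - y)); lra. }
    destruct Hyv as [H1 [H2 H3]]. pose proof (cond_pos eps). split.
    - eapply Rle_trans; [apply Hq; [exact H1 | rewrite Rabs_R0; apply Rabs_pos]|].
      apply Rmult_le_compat_l; lra.
    - eapply Rle_trans; [apply Hq; [apply Rle_refl | exact H1]|].
      apply Rmult_le_compat_l; lra. }
  (* Differentiating O = v T gives q = T + v T'. At v = 0 the quotient reads 0 / 0, which evaluates
     to 0, and this is the true derivative there. *)
  exists (fun v => (q v - T v) / v). intros v.
  destruct (Req_dec v 0) as [->|Hne].
  - rewrite T0, Rminus_diag, Rmult_0_l. replace (0 / 0) with 0 by (unfold Rdiv; ring).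
    split; [|split; [|reflexivity]].
    + apply is_derive_Reals. intros eps Heps.
      destruct (Hsmall (mkposreal (eps / 2) ltac:(lra))) as [d Hd]. simpl in Hd.
      exists d. intros h Hh Hhd. rewrite Rplus_0_l, Rminus_0_r.
      destruct (Hd h Hhd) as [H _]. pose proof (Rabs_pos_lt h Hh).
      unfold Rdiv. rewrite Rabs_mult, Rabs_inv.
      apply Rmult_lt_reg_r with (Rabs h); [assumption|].
      rewrite Rmult_assoc, Rinv_l by lra. nra.
    + apply filterlim_locally. intros eps.
      pose proof (cond_pos eps) as Heps.
      destruct (Hsmall (mkposreal (eps / 2) ltac:(lra))) as [d Hd]. simpl in Hd.
      exists d. intros h Hh. change (Rabs (h - 0) < d) in Hh. rewrite Rminus_0_r in Hh.
      destruct (Hd h Hh) as [_ H].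
      change (Rabs ((q h - T h) / h - (q 0 - T 0) / 0) < eps).
      rewrite T0, Rminus_diag. unfold Rdiv at 2. rewrite Rmult_0_l, Rminus_0_r.
      destruct (Req_dec h 0) as [->|Hne].
      { rewrite T0, Rminus_diag. unfold Rdiv. rewrite Rmult_0_l, Rabs_R0. exact Heps. }
      pose proof (Rabs_pos_lt h Hne).
      unfold Rdiv. rewrite Rabs_mult, Rabs_inv.
      apply Rmult_lt_reg_r with (Rabs h); [assumption|].
      rewrite Rmult_assoc, Rinv_l by lra. nra.
  - assert (Hloc : locally v (fun y => y <> 0)) by now apply open_neq.
    assert (HT : is_derive T v ((q v - T v) / v)).
    { apply is_derive_ext_loc with (fun y => O y / y).
      - apply filter_imp with (2 := Hloc). intros y Hy. symmetry. now apply Tv.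
      - evar_last; [apply (is_derive_div O (fun y => y) v (q v) 1);
          [apply DO | apply (is_derive_id v) | exact Hne]|].
        rewrite (Tv v Hne). simpl. field. exact Hne. }
    split; [exact HT | split; [|field; exact Hne]].
    eapply is_derive_continuous. apply is_derive_div; [|apply (is_derive_id v) | exact Hne].
    apply (is_derive_minus (V := R_NormedModule)); [apply Dq | exact HT].
Qed.

Lemma f_representation (f : R -> R -> R) (u v : R) : C0_C1 f ->
  f u v = odd_part f u v + RInt (ftilde f u) u v + v * ftilde f u v + f0 f u.
Proof.
  intros [Cf Df].
  assert (Cfu : forall y, continuous (f u) y) by (intros; now apply continuous_partial).
  (* Here O = F^-, q = f^+ and T = F^- / v; the derivative of f^+ in v is odd, so it vanishes at
     0. *)
  destruct (quotient_C1 (even_part f u)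
              (fun y => (Derive (f u) y - Derive (f u) (- y)) / 2)
              (odd_part (antider f) u) (Ftilde f u)) as [T1 HT].
  - intros y. apply is_derive_odd_part; now apply is_derive_antider.
  - intros y. apply is_derive_even_part; apply Derive_correct, Df.
  - intros y. unfold Rdiv.
    apply (continuous_mult (K := R_AbsRing)); [|apply continuous_const].
    apply (continuous_minus (V := R_NormedModule)); [apply Df|].
    apply (continuous_comp Ropp (Derive (f u))); [|apply Df].
    apply (continuous_opp (V := R_NormedModule) (fun y => y)), continuous_id.
  - unfold odd_part. rewrite Ropp_0. field.
  - rewrite Ropp_0. field.
  - unfold Ftilde, even_part. destruct (Req_EM_T 0 0); [|lra]. rewrite Ropp_0. field.
  - intros y Hy. unfold Ftilde. destruct (Req_EM_T y 0); [lra | reflexivity].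
  - assert (E : forall y, ftilde f u y = T1 y).
    { intros y. apply is_derive_unique, HT. }
    assert (HI : RInt (ftilde f u) u v = Ftilde f u v - Ftilde f u u).
    { apply (is_RInt_unique (V := R_CompleteNormedModule)).
      apply is_RInt_ext with T1; [intros; symmetry; apply E|].
      apply (is_RInt_derive (V := R_CompleteNormedModule)); intros; apply HT. }
    destruct (HT v) as [_ [_ Hv]].
    rewrite HI, E, Hv. unfold f0, odd_part, even_part. field.
Qed.

Lemma f0_nonzero_iff (f : R -> R -> R) : (forall u v, continuity_2d_pt f u v) ->
  ((exists a : R, RInt (even_part f a) (- a) a <> 0) <-> (exists u : R, f0 f u <> 0)).
Proof.
  intros Cf.
  assert (Cfu : forall u y, continuous (f u) y) by (intros; now apply continuous_partial).
  split.
  - intros [a Ha]. exists a. intros H0. apply Ha.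
    rewrite RInt_even_part_f0, H0 by apply Cfu. apply Rmult_0_r.
  - intros [u Hu]. destruct (Req_dec u 0) as [->|Hne].
    (* At u = 0 the integral is over a point. But f_0(0) = f(0,0), and f stays non-zero on a square
       around the origin; on a = d/2 the mean value theorem writes the integral as 2 a f(a,y) with
       (a,y) in that square. *)
    + assert (H00 : f 0 0 <> 0).
      { unfold f0, Ftilde in Hu. destruct (Req_EM_T 0 0); [exact Hu | lra]. }
      destruct (continuity_2d_pt_neq_0 f 0 0 (Cf 0 0) H00) as [d Hd].
      pose proof (cond_pos d). exists (d / 2). rewrite RInt_even_part by apply Cfu.
      destruct (mean_value (antider f (d / 2)) (f (d / 2)) (- (d / 2)) (d / 2)) as [y [Hy ->]].
      { intros y. now apply is_derive_antider. }
      rewrite Rmin_left, Rmax_right in Hy by lra.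
      apply Rmult_integral_contrapositive. split; [|lra].
      apply Hd; rewrite Rminus_0_r; apply Rabs_def1; lra.
    + exists u. rewrite RInt_even_part_f0 by apply Cfu.
      apply Rmult_integral_contrapositive. split; [lra | exact Hu].
Qed.

(** * Autonomous differential equations with continuous right-hand side *)

(** Separation of variables: A is the inverse of the time function T with T' = 1/c. The lower bound
    keeps 1/c continuous, and the upper bound makes T onto, so that A lives for all times. *)
Lemma exists_autonomous_flow_pos (c : R -> R) (a m M : R) :
  (forall y, continuous c y) -> 0 < m -> (forall y, m <= c y <= M) ->
  exists A : R -> R, A 0 = a /\ forall t, is_derive A t (c (A t)).
Proof.
  intros Cc Hm Hc.
  set (T := fun y => RInt (fun s => / c s) a y).
  assert (Cinv : forall y, continuous (fun s => / c s) y).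
  { intros y. apply (continuous_comp c Rinv); [apply Cc|].
    apply continuity_pt_filterlim.
    apply (continuity_pt_inv (fun z => z)); [apply continuity_pt_id|]. specialize (Hc y). lra. }
  assert (DT : forall y, is_derive T y (/ c y)).
  { intros y. apply (is_derive_RInt (V := R_NormedModule) (fun s => / c s) T a); [|apply Cinv].
    apply filter_forall. intros z. apply (RInt_correct (V := R_CompleteNormedModule)).
    apply (ex_RInt_continuous (V := R_CompleteNormedModule)). auto. }
  assert (Ta : T a = 0) by apply (RInt_point (V := R_CompleteNormedModule)).
  (* This form of the mean value theorem yields the growth of T, the value A 0 = a and the
     difference quotient of A. *)
  assert (Hmv : forall x y, exists z, Rmin x y <= z <= Rmax x y /\ y - x = c z * (T y - T x)).
  { intros x y. destruct (mean_value T (fun z => / c z) x y DT) as [z [Hz ->]].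
    exists z. split; [exact Hz|]. specialize (Hc z). field. lra. }
  assert (inv : forall t, {y : R | T y = t}).
  { intros t. pose proof (Rabs_pos t) as Habs.
    assert (HM : 0 < M) by (specialize (Hc 0); lra).
    assert (0 <= M * Rabs t) by (apply Rmult_le_pos; lra).
    destruct (IVT_gen T (a - M * Rabs t) (a + M * Rabs t) t) as [y [_ Hy]]; [| |now exists y].
    - intros y. apply continuity_pt_filterlim, (is_derive_continuous T y _ (DT y)).
    - assert (Hl : T (a - M * Rabs t) <= - Rabs t).
      { destruct (Hmv a (a - M * Rabs t)) as [z [_ Hz]]. rewrite Ta in Hz.
        specialize (Hc z). nra. }
      assert (Hu : Rabs t <= T (a + M * Rabs t)).
      { destruct (Hmv a (a + M * Rabs t)) as [z [_ Hz]]. rewrite Ta in Hz.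
        specialize (Hc z). nra. }
      pose proof (Rle_abs t). pose proof (Rle_abs (- t)) as Hn. rewrite Rabs_Ropp in Hn.
      rewrite Rmin_left, Rmax_right by lra. lra. }
  set (A := fun t => proj1_sig (inv t)).
  assert (TA : forall t, T (A t) = t) by (intros t; apply (proj2_sig (inv t))).
  exists A. split.
  - destruct (Hmv a (A 0)) as [z [_ Hz]]. rewrite Ta, TA in Hz. lra.
  - intros t. apply is_derive_Reals. intros eps Heps.
    destruct (Cc (A t) _ (locally_ball (c (A t)) (mkposreal eps Heps))) as [d Hd].
    assert (HM : 0 < M) by (specialize (Hc 0); lra).
    (* A moves with speed at most [M], so within time d / M it stays in the ball where c is close to
       c (A t). *)
    assert (HdM : 0 < d / M) by (apply Rdiv_lt_0_compat; [apply cond_pos | exact HM]).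
    exists (mkposreal _ HdM). intros h Hh Hhd. simpl in Hhd.
    destruct (Hmv (A t) (A (t + h))) as [z [Hz HA]].
    rewrite !TA in HA. replace (t + h - t) with h in HA by ring.
    rewrite HA. replace (c z * h / h) with (c z) by (field; exact Hh).
    change (ball (c (A t)) (mkposreal eps Heps) (c z)).
    apply Hd. change (Rabs (z - A t) < d).
    apply Rle_lt_trans with (Rabs (A (t + h) - A t)).
    { unfold Rmin, Rmax in Hz. unfold Rabs.
      destruct (Rle_dec (A t) (A (t + h))), (Rcase_abs (z - A t)),
        (Rcase_abs (A (t + h) - A t)); lra. }
    rewrite HA, Rabs_mult, (Rabs_pos_eq (c z)) by (specialize (Hc z); lra).
    apply Rle_lt_trans with (M * Rabs h).
    { apply Rmult_le_compat_r; [apply Rabs_pos | apply Hc]. }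
    replace (pos d) with (M * (d / M)) by (field; lra). now apply Rmult_lt_compat_l.
Qed.

(** For negative [e], solve with - c and reverse time. The hypothesis confines c between e/2 and
    3e/2. *)
Lemma exists_autonomous_flow (c : R -> R) (a e : R) :
  (forall y, continuous c y) -> 0 < Rabs e -> (forall y, Rabs (c y - e) <= Rabs e / 2) ->
  exists A : R -> R, A 0 = a /\ forall t, is_derive A t (c (A t)).
Proof.
  intros Cc He Hc.
  destruct (Rlt_le_dec 0 e) as [Hp|Hn].
  - rewrite Rabs_pos_eq in He, Hc by lra.
    apply (exists_autonomous_flow_pos c a (e / 2) (3 * e / 2)); [exact Cc | lra|].
    intros y. specialize (Hc y). apply Rabs_le_between in Hc. lra.
  - rewrite Rabs_left1 in He, Hc by lra.
    destruct (exists_autonomous_flow_pos (fun y => - c y) a (- e / 2) (- 3 * e / 2))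
      as [B [B0 DB]].
    + intros y. apply (continuous_opp (V := R_NormedModule)), Cc.
    + lra.
    + intros y. specialize (Hc y). apply Rabs_le_between in Hc. lra.
    + exists (fun t => B (- t)). rewrite Ropp_0. split; [exact B0|].
      intros t. rewrite <- (Ropp_involutive (c (B (- t)))). apply is_derive_comp_Ropp, DB.
Qed.

(** For d >= 0 this is the nearest-point projection onto [a - d, a + d]; absolute values make its
    continuity immediate. *)
Definition clamp (a d y : R) : R := a + (Rabs (y - a + d) - Rabs (y - a - d)) / 2.

Lemma clamp_id (a d y : R) : Rabs (y - a) <= d -> clamp a d y = y.
Proof.
  intros H. apply Rabs_le_between in H. unfold clamp.
  rewrite Rabs_pos_eq, Rabs_left1 by lra. field.
Qed.

Lemma clamp_range (a d y : R) : 0 <= d -> Rabs (clamp a d y - a) <= d.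
Proof.
  intros Hd. unfold clamp. apply Rabs_le.
  unfold Rabs. destruct (Rcase_abs (y - a + d)), (Rcase_abs (y - a - d)); lra.
Qed.

Lemma continuous_clamp (a d y : R) : continuous (clamp a d) y.
Proof.
  assert (Hc : forall k, continuous (fun z => Rabs (z - a + k)) y).
  { intros k. apply (continuous_comp (fun z => z - a + k) Rabs); [|apply continuous_Rabs].
    eapply is_derive_continuous. auto_derive; [trivial | reflexivity]. }
  apply (continuous_plus (V := R_NormedModule)); [apply continuous_const|].
  apply (continuous_mult (K := R_AbsRing)); [|apply continuous_const].
  apply (continuous_minus (V := R_NormedModule)); [apply Hc | apply (Hc (- d))].
Qed.

(** Composing [c] with the clamp extends its bounds near [a] to the whole line. For short times the
    global solution has not left the interval on which the clamp is the identity. *)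
Lemma exists_local_autonomous_flow (c : R -> R) (a : R) :
  (forall y, continuous c y) -> c a <> 0 -> a <> 0 ->
  exists (A : R -> R) (d : R), 0 < d /\ A 0 = a /\
    forall t, - d < t < d -> is_derive A t (c (A t)) /\ A t <> 0.
Proof.
  intros Cc Hca Ha.
  assert (He : 0 < Rabs (c a) / 2) by (pose proof (Rabs_pos_lt _ Hca); lra).
  assert (Hloc : locally a (fun y => Rabs (c y - c a) < Rabs (c a) / 2 /\ y <> 0)).
  { apply filter_and; [|now apply open_neq].
    exact (Cc a _ (locally_ball (c a) (mkposreal _ He))). }
  destruct Hloc as [r Hr]. pose proof (cond_pos r) as Hr0.
  destruct (exists_autonomous_flow (fun y => c (clamp a (r / 2) y)) a (c a)) as [A [A0 DA]].
  - intros y. apply (continuous_comp (clamp a (r / 2)) c); [apply continuous_clamp | apply Cc].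
  - now apply Rabs_pos_lt.
  - intros y. apply Rlt_le, Hr. change (Rabs (clamp a (r / 2) y - a) < r).
    apply Rle_lt_trans with (r / 2); [apply clamp_range|]; lra.
  - assert (HA : locally 0 (fun t => Rabs (A t - a) < r / 2)).
    { assert (Hr2 : 0 < r / 2) by lra.
      pose proof (is_derive_continuous A 0 _ (DA 0) _ (locally_ball (A 0) (mkposreal _ Hr2))) as H.
      rewrite A0 in H. exact H. }
    destruct HA as [d Hd]. exists A, d. split; [apply cond_pos|]. split; [exact A0|].
    intros t Ht. assert (HAt : Rabs (A t - a) < r / 2).
    { apply Hd. change (Rabs (t - 0) < d). rewrite Rminus_0_r. now apply Rabs_def1. }
    split.
    + rewrite <- (clamp_id a (r / 2) (A t)) by lra. apply DA.
    + apply Hr. change (Rabs (A t - a) < r). lra.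
Qed.

(** * From the two differential equations back to peaked waves *)

Lemma C1_on_of_is_derive (t1 t2 : Rbar) (h k : R -> R) :
  (forall t, in_itv t1 t2 t -> is_derive h t (k t) /\ continuous k t) -> C1_on t1 t2 h.
Proof.
  intros H t Hin. destruct (H t Hin) as [D C]. split; [now exists (k t)|].
  apply continuous_ext_loc with k; [|exact C].
  apply filter_imp with (2 := in_itv_open _ _ _ Hin).
  intros s Hs. symmetry. now apply is_derive_unique, H.
Qed.

(** The two equations annihilate both coefficients of the reduced weak form, so its integrand is
    zero pointwise for every test function. *)
Lemma dynamical_peaked_wave_of_odes (f g : R -> R -> R) (t1 t2 : Rbar) (A X : R -> R) :
  (forall u v, continuity_2d_pt f u v) -> (forall u v, continuity_2d_pt g u v) ->
  C1_on t1 t2 A -> C1_on t1 t2 X -> (forall t, in_itv t1 t2 t -> A t <> 0) ->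
  (forall t, in_itv t1 t2 t ->
     2 * Derive A t = antider f (A t) (- A t) - antider f (A t) (A t)) ->
  (forall t, in_itv t1 t2 t ->
     2 * A t * Derive X t = - (antider g (A t) (- A t) - antider g (A t) (A t))) ->
  dynamical_peaked_wave f g t1 t2 A X.
Proof.
  intros Cf Cg HA HX HA0 OA OX. split; [exact HA|]. split; [exact HX|]. split; [exact HA0|].
  exists (fun t => antider f (A t) (- A t) - antider f (A t) (A t)),
    (fun t => antider g (A t) (- A t) - antider g (A t) (A t)).
  split; [intros t _; split; now apply peakon_jump|].
  intros phi xa xb ta tb Hphi Hx Ht Ha Hb Hsupp integrand. split.
  - intros t _. exists (- 2 * A t * dt phi (X t) t). now apply is_RInt_peakon_integrand with ta tb.
  - refine (proj1 (weak_form_by_parts f g t1 t2 A X _ _ phi xa xb ta tb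
                     HA HX Hphi Hx Ht Ha Hb Hsupp) _).
    apply is_RInt_zero_on. intros t. rewrite Rmin_left, Rmax_right by lra. intros Hi.
    assert (Hin : in_itv t1 t2 t) by (apply in_itv_between with ta tb; auto; lra).
    rewrite OA, OX by exact Hin. ring.
Qed.

Theorem lemma1 (f g : R -> R -> R) (hf : C0_C1 f) (hg : C0_C1 g) :
  ((exists (t1 t2 : Rbar) (A X : R -> R),
      dynamical_peaked_wave f g t1 t2 A X /\ nonconstant_on t1 t2 A)
   <->
   (exists a : R, RInt (even_part f a) (- a) a <> 0))
  /\
  (forall u v : R,
     f u v = odd_part f u v + RInt (ftilde f u) u v + v * ftilde f u v + f0 f u)
  /\
  ((exists a : R, RInt (even_part f a) (- a) a <> 0)
   <->
   (exists u : R, f0 f u <> 0)).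
Proof.
  split; [|split; [intros u v; now apply f_representation | apply f0_nonzero_iff, hf]].
  destruct hf as [Cf _], hg as [Cg _].
  assert (Cfu : forall u y, continuous (f u) y) by (intros; now apply continuous_partial).
  set (jump := fun (h : R -> R -> R) a => antider h a (- a) - antider h a a).
  assert (Hjump : forall a, RInt (even_part f a) (- a) a = - jump f a).
  { intros a. rewrite RInt_even_part by apply Cfu. unfold jump. apply Rminus_diag_uniq. ring. }
  assert (Cjump : forall h a, (forall u v, continuity_2d_pt h u v) -> continuous (jump h) a).
  { intros h a Ch. apply (continuous_minus (V := R_NormedModule)
             (fun a => antider h a (- a)) (fun a => antider h a a)).
    - apply continuous_ext with (fun v => antider h v (-1 * v)); [intros v; f_equal; ring|].
      now apply continuous_antider_ray.
    - apply continuous_ext with (fun v => antider h v (1 * v)); [intros v; f_equal; ring|].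
      now apply continuous_antider_ray. }
  split.
  - intros [t1 [t2 [A [X [[HA [HX [_ Hweak]]] [s [t [Hs [Ht Hst]]]]]]]]].
    apply NNPP. intros Hno. apply Hst.
    assert (DA : forall r, in_itv t1 t2 r -> is_derive A r 0).
    { intros r Hr. destruct (HA r Hr) as [Dr _]. apply Derive_correct in Dr.
      replace 0 with (Derive A r); [exact Dr|].
      pose proof (weak_solution_amplitude f g t1 t2 A X r Cf Cg HA HX Hweak Hr) as E.
      fold (jump f (A r)) in E.
      destruct (Req_dec (jump f (A r)) 0) as [H0|H0]; [lra|].
      exfalso. apply Hno. exists (A r). rewrite Hjump. lra. }
    assert (Hin : forall r, Rmin s t <= r <= Rmax s t -> in_itv t1 t2 r).
    { intros r Hr. apply in_itv_between with (Rmin s t) (Rmax s t); [| |exact Hr].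
      - unfold Rmin. now destruct (Rle_dec s t).
      - unfold Rmax. now destruct (Rle_dec s t). }
    destruct (MVT_gen A s t (fun _ => 0)) as [r [_ Hr]]; [| |lra].
    + intros r Hr. apply DA, Hin. lra.
    + intros r Hr. apply continuity_pt_filterlim, (is_derive_continuous A r 0), DA, Hin, Hr.
  - intros [a Ha]. rewrite Hjump in Ha.
    (* The initial amplitude is [a], and a peaked wave must not vanish. *)
    assert (Ha0 : a <> 0).
    { intros ->. apply Ha. unfold jump. rewrite Ropp_0, Rminus_diag. apply Ropp_0. }
    destruct (exists_local_autonomous_flow (fun y => / 2 * jump f y) a) as [A [d [Hd [A0 HA]]]].
    + intros y. apply (continuous_mult (K := R_AbsRing)); [apply continuous_const|].
      now apply Cjump.
    + lra.
    + exact Ha0.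
    + set (speed := fun t => - jump g (A t) / (2 * A t)).
      assert (CA : forall t, - d < t < d -> continuous A t).
      { intros t Ht. destruct (HA t Ht) as [DA _]. exact (is_derive_continuous A t _ DA). }
      assert (Cspeed : forall t, - d < t < d -> continuous speed t).
      { intros t Ht. apply (continuous_comp A (fun y => - jump g y / (2 * y))); [now apply CA|].
        apply (continuous_mult (K := R_AbsRing)).
        - apply (continuous_opp (V := R_NormedModule)). now apply Cjump.
        - destruct (HA t Ht) as [_ HA0]. eapply is_derive_continuous.
          auto_derive; [lra | reflexivity]. }
      set (X := fun t => RInt speed 0 t).
      assert (DX : forall t, - d < t < d -> is_derive X t (speed t)).
      { intros t Ht.
        apply (is_derive_RInt (V := R_NormedModule) speed X 0);
          [|now apply Cspeed].
        apply locally_interval with (- d) d; try apply Ht. intros y Hy1 Hy2. simpl in Hy1, Hy2.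
        apply (RInt_correct (V := R_CompleteNormedModule)).
        apply (ex_RInt_continuous (V := R_CompleteNormedModule)). intros z Hz. apply Cspeed.
        unfold Rmin, Rmax in Hz. destruct (Rle_dec 0 y); lra. }
      exists (- d), d, A, X. split.
      * apply dynamical_peaked_wave_of_odes; try assumption.
        -- apply C1_on_of_is_derive with (fun t => / 2 * jump f (A t)). intros t Ht.
           split; [now apply HA|]. apply (continuous_mult (K := R_AbsRing));
             [apply continuous_const|].
           apply (continuous_comp A (jump f)); [now apply CA | now apply Cjump].
        -- apply C1_on_of_is_derive with speed. intros t Ht.
           split; [now apply DX | now apply Cspeed].
        -- intros t Ht. now apply HA.
        -- intros t Ht. destruct (HA t Ht) as [DA _]. rewrite (is_derive_unique _ _ _ DA).
           fold (jump f (A t)). field.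
        -- intros t Ht. destruct (HA t Ht) as [_ HA0]. rewrite (is_derive_unique _ _ _ (DX t Ht)).
           fold (jump g (A t)). unfold speed. field. exact HA0.
      * apply NNPP. intros Hconst.
        (* A constant amplitude would have derivative 0 at time 0, but the flow gives it the
           non-zero value [jump f a] / 2. *)
        assert (DA0 : is_derive A 0 0).
        { apply is_derive_ext_loc with (fun _ => a); [|auto_derive; [trivial | reflexivity]].
          apply locally_interval with (- d) d; [simpl; lra | simpl; lra|].
          intros t Ht1 Ht2. rewrite <- A0. apply NNPP. intros Hne. apply Hconst.
          exists 0, t. repeat split; simpl; try lra; auto. }
        destruct (HA 0) as [DA _]; [lra|].
        apply is_derive_unique in DA0. apply is_derive_unique in DA. rewrite A0 in DA. lra.
Qed.
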